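(* Let $A_1$ and $A_2$ be quasi-isomorphic cluster algebras. Then $A_1$ has no mysterious points if and only if $A_2$ has no mysterious points.
   Context: Cluster algebras are skew-symmetric of geometric type over $\mathbb{C}$: an extended exchange matrix is an $(n+m)\times n$ integer matrix $\tilde B=(b_{ij})$ with skew-symmetric top $n\times n$ block; a seed is $(\tilde{\mathbf x},\tilde B)$ with $\tilde{\mathbf x}=(x_1,\dots,x_{n+m})$ freely generating $\mathcal F=\mathbb{C}(x_1,\dots,x_{n+m})$; mutation at $k\le n$ performs matrix mutation and replaces $x_k$ by $x_k^{-1}\big(\prod_{b_{ik}>0}x_i^{b_{ik}}+\prod_{b_{ik}<0}x_i^{-b_{ik}}\big)$; $A$ is the $\mathbb{C}[x_{n+1}^{\pm1},\dots,x_{n+m}^{\pm1}]$-subalgebra generated by all cluster variables of the set $\Sigma(A)$ of seeds obtained by iterated mutation. $\mathcal A=\operatorname{Spec}A$; the cluster torus $T(t)$ of $t\in\Sigma(A)$ is the locus where all variables of $t$ are nonzero; $\mathcal D(\mathcal A)=\mathcal A\setminus\bigcup_tT(t)$. $\operatorname{Aut}(A)$ is the group of algebra automorphisms sending every (mutable or frozen) variable to a nonzero scalar multiple of itself; $\mathcal S(\mathcal A)$ is the set of points with nontrivial $\operatorname{Aut}(A)$-stabilizer. $A$ has no mysterious points if $\mathcal S(\mathcal A)=\mathcal D(\mathcal A)$. Quasi-morphisms. Let $\mathcal A_i=\operatorname{Spec}A_i$ ($i=1,2$) have the same number $n$ of mutable and $m$ of frozen variables. A cluster quasi-morphism from $\mathcal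 A_2$ to $\mathcal A_1$ is a triple $(\Psi,\Phi,(R_t)_{t\in\Sigma(A_1)})$ where $\Psi:\mathcal A_2\to\mathcal A_1$ is a morphism of varieties with dual $\Psi^*:A_1\to A_2$; $\Phi:\Sigma(A_1)\to\Sigma(A_2)$ is a map commuting with mutation; and for each $t$, $R_t$ is an $(n+m)\times(n+m)$ integer matrix of the form $\begin{pmatrix}I_n&0\\P_t&Q_t\end{pmatrix}$ such that, writing $t=(\mathbf z,\tilde B_1)$ and $\Phi(t)=(\mathbf x,\tilde B_2)$, one has $\tilde B_2=R_t\tilde B_1$ and $\Psi^*(z_j)=\prod_{i=1}^{n+m}x_i^{(R_t)_{ij}}$. It is a cluster quasi-isomorphism if $\Psi$ is an isomorphism (equivalently $R_t\in\mathrm{GL}(n+m,\mathbb{Z})$ for some $t$). $A_1$, $A_2$ are quasi-isomorphic if a cluster quasi-isomorphism exists. *)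

(* Defs.v *)
From HB Require Import structures.
From mathcomp Require Import all_boot all_order all_algebra.
From mathcomp Require Import boolp classical_sets reals complex mpoly.

Set Implicit Arguments.
Unset Strict Implicit.
Unset Printing Implicit Defensive.

Import Order.TTheory GRing.Theory Num.Theory.

Local Open Scope classical_set_scope.
Local Open Scope ring_scope.

(* [R[i]] with [R : realType] is the field of complex numbers. *)
Definition ratfun (R : realType) (N : nat) := {fraction {mpoly R[i][N]}}.

Section RatfunAlgebra.
Variables (R : realType) (N : nat).
Local Notation F := (ratfun R N).

HB.instance Definition _ := GRing.Field.on F.

Definition ratfunC : {rmorphism R[i] -> F} :=
  @FracField.tofrac {mpoly R[i][N]} \o @mpolyC N R[i].

Definition ratfun_scale (c : R[i]) (f : F) : F := ratfunC c * f.

Fact ratfun_scaleA a b f :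
  ratfun_scale a (ratfun_scale b f) = ratfun_scale (a * b) f.
Proof. by rewrite /ratfun_scale rmorphM mulrA. Qed.

Fact ratfun_scale1 : left_id 1 ratfun_scale.
Proof. by move=> f; rewrite /ratfun_scale rmorph1 mul1r. Qed.

Fact ratfun_scaleDr : right_distributive ratfun_scale +%R.
Proof. by move=> c f g; rewrite /ratfun_scale mulrDr. Qed.

Fact ratfun_scaleDl f : {morph ratfun_scale^~ f : a b / a + b}.
Proof. by move=> a b; rewrite /ratfun_scale rmorphD mulrDl. Qed.

HB.instance Definition _ := GRing.Zmodule_isLmodule.Build R[i] F
  ratfun_scaleA ratfun_scale1 ratfun_scaleDr ratfun_scaleDl.

Fact ratfun_scaleAl (c : R[i]) (f g : F) : c *: (f * g) = (c *: f) * g.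
Proof. exact: mulrA. Qed.

HB.instance Definition _ :=
  GRing.Lmodule_isLalgebra.Build R[i] F ratfun_scaleAl.

Fact ratfun_scaleAr (c : R[i]) (f g : F) : c *: (f * g) = f * (c *: g).
Proof. exact: mulrCA. Qed.

HB.instance Definition _ :=
  GRing.Lalgebra_isAlgebra.Build R[i] F ratfun_scaleAr.

End RatfunAlgebra.

(* Indices [lshift m k] with [k : 'I_n] are mutable, indices [rshift n j] with
   [j : 'I_m] are frozen. *)
Record seed (R : realType) (n m : nat) := Seed {
  vars : {ffun 'I_(n + m) -> ratfun R (n + m)};
  exmx : 'M[int]_(n + m, n)
}.

Definition freely_generates (R : realType) (N : nat) (x : 'I_N -> ratfun R N) :=
  let ev := mmap (@ratfunC R N) x in
  (forall p : {mpoly R[i][N]}, ev p = 0 -> p = 0) /\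
  (forall f : ratfun R N, exists p q : {mpoly R[i][N]},
     ev q != 0 /\ f = ev p / ev q).

Definition is_seed (R : realType) (n m : nat) (t : seed R n m) :=
  freely_generates (vars t) /\ (usubmx (exmx t))^T = - usubmx (exmx t).

Section ClusterAlgebra.
Variables (R : realType) (n m : nat).
Implicit Type t : seed R n m.

Definition mutate_mx (k : 'I_n) (B : 'M[int]_(n + m, n)) : 'M[int]_(n + m, n) :=
  \matrix_(i, j)
    if (i == lshift m k) || (j == k) then - B i j
    else B i j + Num.sg (B i k) * Num.max 0 (B i k * B (lshift m k) j).

Definition exchange t (k : 'I_n) : ratfun R (n + m) :=
  (vars t (lshift m k))^-1 *
  (\prod_(i | 0 < exmx t i k) vars t i ^ exmx t i k +
   \prod_(i | exmx t i k < 0) vars t i ^ (- exmx t i k)).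

Definition mutate (k : 'I_n) t : seed R n m :=
  Seed [ffun i => if i == lshift m k then exchange t k else vars t i]
       (mutate_mx k (exmx t)).

Inductive mutation_equiv t0 : seed R n m -> Prop :=
| mutation_equiv_refl : mutation_equiv t0 t0
| mutation_equiv_step k t :
    mutation_equiv t0 t -> mutation_equiv t0 (mutate k t).

(* A cluster algebra A is given by an initial seed [t0]: [seeds t0] is Sigma(A),
   a set of labeled seeds, and [calg t0] below is A. *)
Definition seeds t0 := {t : seed R n m | mutation_equiv t0 t}.

Definition mutate_seeds t0 (k : 'I_n) (t : seeds t0) : seeds t0 :=
  exist _ (mutate k (sval t)) (mutation_equiv_step k (svalP t)).

Inductive in_calg t0 : ratfun R (n + m) -> Prop :=
| in_calg_const (c : R[i]) : in_calg t0 c%:A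
| in_calg_var t i : mutation_equiv t0 t -> in_calg t0 (vars t i)
| in_calg_frozenV (j : 'I_m) : in_calg t0 (vars t0 (rshift n j))^-1
| in_calg_add f g : in_calg t0 f -> in_calg t0 g -> in_calg t0 (f + g)
| in_calg_mul f g : in_calg t0 f -> in_calg t0 g -> in_calg t0 (f * g).

Definition calg_pred t0 : {pred ratfun R (n + m)} := fun f => `[< in_calg t0 f >].

Fact calg_pred_subalg t0 : subalg_closed (calg_pred t0).
Proof.
have cZ c f : in_calg t0 f -> in_calg t0 (c *: f).
  by move=> Af; rewrite -mulr_algl; apply: in_calg_mul => //; apply: in_calg_const.
split=> [|c f g /asboolP Af /asboolP Ag|f g /asboolP Af /asboolP Ag].
- by apply/asboolP; rewrite -[1]scale1r; apply: in_calg_const.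
- by apply/asboolP/in_calg_add => //; apply: cZ.
- by apply/asboolP/in_calg_mul.
Qed.

HB.instance Definition _ t0 :=
  GRing.isSubalgClosed.Build R[i] (ratfun R (n + m)) (calg_pred t0)
    (GRing.subalg_closed_semi (calg_pred_subalg t0)).

Record calg t0 := Calg {
  calg_val : ratfun R (n + m);
  calg_valP : calg_val \in calg_pred t0
}.

HB.instance Definition _ t0 := [isSub for @calg_val t0].
HB.instance Definition _ t0 := [Choice of calg t0 by <:].
HB.instance Definition _ t0 := [SubChoice_isSubAlgebra of calg t0 by <:].
HB.instance Definition _ t0 := [SubNzRing_isSubComNzRing of calg t0 by <:].

Fact cvar_subproof t0 (t : seeds t0) i : vars (sval t) i \in calg_pred t0.
Proof. exact/asboolP/in_calg_var/(svalP t). Qed.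

Definition cvar t0 (t : seeds t0) (i : 'I_(n + m)) : calg t0 :=
  Calg (cvar_subproof t i).

(* The points of the variety Spec A are its closed points.  As A has countable
   dimension over the uncountable field [R[i]], the residue field of a maximal
   ideal is [R[i]], so these are the algebra morphisms from A to [R[i]]. *)
Definition cpoint t0 := {lrmorphism calg t0 -> R[i]^o}.

Definition cluster_torus t0 (t : seeds t0) : set (cpoint t0) :=
  [set p : cpoint t0 | forall i, p (cvar t i) != 0].

Definition deep_points t0 : set (cpoint t0) :=
  ~` \bigcup_(t in [set: seeds t0]) cluster_torus t.

Definition is_cluster_aut t0 (s : {lrmorphism calg t0 -> calg t0}) :=
  bijective s /\
  forall (t : seeds t0) i, exists2 c : R[i], c != 0 & s (cvar t i) = c *: cvar t i.

(* An automorphism [s] acts on points by precomposition. *)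
Definition stabilized_points t0 : set (cpoint t0) :=
  [set p : cpoint t0 | exists s : {lrmorphism calg t0 -> calg t0},
     [/\ is_cluster_aut s, ~ (s =1 id) & forall a, p (s a) = p a]].

Definition no_mysterious_points t0 := (@stabilized_points t0 = @deep_points t0).

(* A quasi-morphism from Spec A_2 to Spec A_1, where A_1 and A_2 are the cluster
   algebras of [t1] and [t2].  The morphism Psi of affine varieties is given by
   its dual [qm_dual]; it is an isomorphism iff [qm_dual] is bijective. *)
Record quasi_morphism (t1 t2 : seed R n m) := QuasiMorphism {
  qm_dual : {lrmorphism calg t1 -> calg t2};
  qm_seed : seeds t1 -> seeds t2;
  qm_mx : seeds t1 -> 'M[int]_(n + m);
  qm_seed_mutate : forall k (t : seeds t1),
    qm_seed (mutate_seeds k t) = mutate_seeds k (qm_seed t);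
  qm_mx_block : forall t : seeds t1, exists (P : 'M_(m, n)) (Q : 'M_m),
    qm_mx t = block_mx 1%:M 0 P Q;
  qm_exmx : forall t : seeds t1,
    exmx (sval (qm_seed t)) = qm_mx t *m exmx (sval t);
  qm_var : forall (t : seeds t1) j, val (qm_dual (cvar t j)) =
    \prod_(i < n + m) vars (sval (qm_seed t)) i ^ qm_mx t i j
}.

Definition quasi_isomorphic (t1 t2 : seed R n m) :=
  exists q : quasi_morphism t1 t2, bijective (qm_dual q).

End ClusterAlgebra.

(* Main.v *)
(* Let Psi^* : A_1 -> A_2 be the dual of a quasi-isomorphism. Mutation is an
   involution on the seeds of A_2, so the mutation-equivariant map Phi is onto.
   The images of the variables of a seed t of A_1 are, up to units (monomials in
   the frozen variables), the mutable variables of Phi(t), and monomials in the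
   frozen variables; hence Psi matches the cluster tori, and so the deep points.
   Conjugation by Psi^* identifies the groups Aut(A_i). The only non-formal point
   is that an automorphism of A_2 that scales the Psi^*(z_j) scales every frozen
   variable y_i: since Psi^* is injective and the variables of A_1 are
   algebraically independent, det Q <> 0 and some positive power of y_i is scaled,
   and a function with a constant power is constant because C is algebraically
   closed. *)

From HB Require Import structures.
Require Import Defs.
From mathcomp Require Import all_boot all_order all_algebra.
From mathcomp Require Import boolp classical_sets reals complex mpoly zify.

Set Implicit Arguments.
Unset Strict Implicit.
Unset Printing Implicit Defensive.

Import Order.TTheory GRing.Theory Num.Theory.

Local Open Scope ring_scope.

(** * Fractions with a positive value at a point *)

Section PositiveFractions.
Variables (K : numDomainType) (P : comNzRingType) (F : fieldType).
Variables (ev : {rmorphism P -> F}) (at1 : {rmorphism P -> K}).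
Hypothesis ev_inj : forall p, ev p = 0 -> p = 0.

(* An elementary substitute for subtraction-free rational expressions: these
   fractions are closed under addition, product and inverse, and nonzero. *)
Definition pos_frac (f : F) :=
  exists p q : P, [/\ 0 < at1 p, 0 < at1 q & f = ev p / ev q].

Lemma ev_neq0 p : 0 < at1 p -> ev p != 0.
Proof.
move=> p_gt0; apply/eqP => /ev_inj p0.
by move: p_gt0; rewrite p0 rmorph0 ltxx.
Qed.

Lemma pos_frac_neq0 f : pos_frac f -> f != 0.
Proof.
by case=> p [q [/ev_neq0 p0 /ev_neq0 q0 ->]]; rewrite mulf_neq0 ?invr_neq0.
Qed.

Lemma pos_frac_ev p : 0 < at1 p -> pos_frac (ev p).
Proof. by move=> p0; exists p, 1; rewrite !rmorph1 ltr01 divr1. Qed.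

Lemma pos_frac1 : pos_frac 1.
Proof. by rewrite -(rmorph1 ev); apply: pos_frac_ev; rewrite rmorph1 ltr01. Qed.

Lemma pos_fracD f g : pos_frac f -> pos_frac g -> pos_frac (f + g).
Proof.
case=> p [q [p0 q0 ->]] [p' [q' [p'0 q'0 ->]]].
exists (p * q' + p' * q), (q * q').
split; rewrite ?rmorphD ?rmorphM ?addr_gt0 ?mulr_gt0 //=.
by rewrite addf_div ?ev_neq0.
Qed.

Lemma pos_fracM f g : pos_frac f -> pos_frac g -> pos_frac (f * g).
Proof.
case=> p [q [p0 q0 ->]] [p' [q' [p'0 q'0 ->]]].
exists (p * p'), (q * q').
by split; rewrite ?rmorphM ?mulr_gt0 //= mulf_div.
Qed.

Lemma pos_fracV f : pos_frac f -> pos_frac f^-1.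
Proof. by case=> p [q [p0 q0 ->]]; exists q, p; rewrite invf_div. Qed.

Lemma pos_fracXz f (z : int) : pos_frac f -> pos_frac (f ^ z).
Proof.
have posX (n : nat) : pos_frac f -> pos_frac (f ^+ n).
  move=> f_pos; elim: n => [|n IHn]; first exact: pos_frac1.
  by rewrite exprS; apply: pos_fracM.
by case: z => n f_pos; [exact: posX | apply/pos_fracV/posX].
Qed.

End PositiveFractions.

(** * Roots of constants; induction on integer columns *)

Lemma constant_root (C : closedFieldType) (F : fieldType)
    (iota : {rmorphism C -> F}) d (u : F) (c : C) :
  (0 < d)%N -> u ^+ d = iota c -> exists b, u = iota b.
Proof.
move=> d_gt0 ud.
(* [X^d - c] splits over the closed field [C], so its root [u] in [F] is the image of one of its
   roots in [C]. *)
have [r pE] := closed_field_poly_normal ('X^d - c%:P).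
have p_neq0 : lead_coef ('X^d - c%:P : {poly C}) != 0.
  by rewrite lead_coef_eq0 -size_poly_eq0 size_XnsubC.
move: pE; set a := lead_coef _ in p_neq0 * => pE.
have /eqP : (map_poly iota ('X^d - c%:P)).[u] = 0.
  by rewrite rmorphB /= map_polyXn map_polyC !hornerE ud subrr.
rewrite pE linearZ hornerZ mulf_eq0 fmorph_eq0 (negPf p_neq0) /=.
rewrite rmorph_prod horner_prod; elim: r {pE} => [|b r IHr].
  by rewrite big_nil oner_eq0.
rewrite big_cons mulf_eq0 rmorphB /= map_polyX map_polyC !hornerE subr_eq0.
by case/orP => [/eqP ->|/IHr //]; exists b.
Qed.

(** The unit columns generate the group of integer columns; claims on Laurent monomials thus reduce
    to single variables. *)
Lemma int_cV_ind k (T : 'cV[int]_k -> Prop) :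
  T 0 -> (forall v w, T v -> T w -> T (v + w)) -> (forall v, T v -> T (- v)) ->
  (forall i, T (delta_mx i 0)) -> forall v, T v.
Proof.
move=> T0 TD TN Tdelta v.
have TZ (a : int) w : T w -> T (a *: w).
  move=> Tw; suff TZn (b : nat) : T (b%:Z *: w).
    by case: a => b; [exact: TZn | rewrite NegzE scaleNr; apply/TN/TZn].
  by elim: b => [|b IHb]; rewrite ?scale0r // intS scalerDl scale1r; apply: TD.
rewrite (matrix_sum_delta v); apply: big_ind => // i _.
by rewrite big_ord1; apply: TZ.
Qed.

(** * Laurent monomials as functions of the exponent vector *)

Section LaurentMonomials.
Variables (F : fieldType) (k : nat) (y : 'I_k -> F).
Hypothesis y_neq0 : forall i, y i != 0.

Definition laurent (v : 'cV[int]_k) : F := \prod_i y i ^ v i 0.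

Lemma laurent0 : laurent 0 = 1.
Proof. by rewrite /laurent big1 // => i _; rewrite mxE. Qed.

Lemma laurentD v w : laurent (v + w) = laurent v * laurent w.
Proof.
by rewrite /laurent -big_split; apply: eq_bigr => i _; rewrite mxE expfzDr.
Qed.

Lemma laurentZdelta (a : int) i : laurent (a *: delta_mx i 0) = y i ^ a.
Proof.
rewrite /laurent (bigD1 i) //= big1 => [|j /negPf ji].
  by rewrite !mxE !eqxx mulr1 mulr1.
by rewrite !mxE ji mulr0.
Qed.

End LaurentMonomials.

(** * Mutation as an involution on reachable seeds *)

Section Mutation.
Variables (R : realType) (n m : nat).
Implicit Types (t u v : seed R n m) (B : 'M[int]_(n + m, n)).

Definition skew_top B := (usubmx B)^T = - usubmx B.

Lemma skew_topP B :
  skew_top B <-> forall i j, B (lshift m j) i = - B (lshift m i) j.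
Proof.
split=> [/matrixP skewB i j | skewB]; last by apply/matrixP => i j; rewrite !mxE.
by have := skewB i j; rewrite !mxE.
Qed.

Lemma mutate_mx_skew k B : skew_top B -> skew_top (mutate_mx k B).
Proof.
move=> /skew_topP skewB; apply/skew_topP => i j; rewrite !mxE.
rewrite !(inj_eq (@lshift_inj _ _)) [(j == k) || _]orbC.
rewrite (skewB i j) (skewB k j) (skewB i k); case: ifP => _ //.
rewrite mulrNN opprD; set a := B (lshift m k) j; set b := B (lshift m i) k.
rewrite [b * a]mulrC.
(* The correction term vanishes unless [a * b > 0], and then [a] and [b] have the same sign. *)
have [ab_gt0|ab_le0] := ltrP 0 (a * b); last by rewrite !mulr0 oppr0.
rewrite sgrN mulNr; suff -> : Num.sg a = Num.sg b by [].
by have := sgrM a b; rewrite gtr0_sg //; case: sgrP => _; case: sgrP.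
Qed.

(** Off row and column [k], the product [B i k * B (lshift m k) j] is kept since both factors change
    sign, while the sign of [B i k] flips: the two corrections cancel. *)
Lemma mutate_mxK k B : mutate_mx k (mutate_mx k B) = B.
Proof.
apply/matrixP => i j; rewrite !mxE !eqxx !orbT /=.
case: (_ || _); first by rewrite opprK.
by rewrite mulrNN sgrN mulNr addrK.
Qed.

Lemma vars_mutate k t i : i != lshift m k -> vars (mutate k t) i = vars t i.
Proof. by move=> /negPf ik; rewrite ffunE ik. Qed.

Definition exchange_binomial t (k : 'I_n) : ratfun R (n + m) :=
  \prod_(i | 0 < exmx t i k) vars t i ^ exmx t i k +
  \prod_(i | exmx t i k < 0) vars t i ^ (- exmx t i k).

(** Column [k] changes sign, so the two products trade places; [x_k], the only changed variable,
    does not occur because [b_kk = 0] by skew-symmetry. *)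
Lemma exchange_binomial_mutate k t : skew_top (exmx t) ->
  exchange_binomial (mutate k t) k = exchange_binomial t k.
Proof.
move=> /skew_topP skewB.
have Bkk : exmx t (lshift m k) k = 0.
  by have := skewB k k; move: (exmx t _ _) => b; lia.
have colk i : mutate_mx k (exmx t) i k = - exmx t i k by rewrite mxE eqxx orbT.
rewrite /exchange_binomial addrC; congr (_ + _); apply: eq_big => i /=;
  rewrite colk ?oppr_lt0 ?oppr_gt0 ?opprK // => Bik;
  by rewrite (@vars_mutate k) //; apply: contraTneq Bik => ->; rewrite Bkk ltxx.
Qed.

Lemma mutateK k t : skew_top (exmx t) -> vars t (lshift m k) != 0 ->
  exchange_binomial t k != 0 -> mutate k (mutate k t) = t.
Proof.
move=> skewB xk_neq0 binom_neq0.
have exchK : exchange (mutate k t) k = vars t (lshift m k).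
  rewrite /exchange -/(exchange_binomial _ _) exchange_binomial_mutate //.
  rewrite /= ffunE eqxx /exchange -/(exchange_binomial _ _) invfM invrK.
  by rewrite -mulrA mulVf ?mulr1.
case: t skewB xk_neq0 binom_neq0 exchK => x B _ _ _ exchK.
rewrite {1}/mutate mutate_mxK exchK; congr Seed.
by apply/ffunP => i; rewrite !ffunE; case: eqP => [->|].
Qed.

(** Positivity is tested where all variables of [t0] equal 1; it survives exchange relations and
    keeps variables and exchange binomials nonzero. *)
Definition pos_seed t0 t :=
  skew_top (exmx t) /\
  forall i, pos_frac (mmap (@ratfunC R (n + m)) (vars t0))
                     (@meval (n + m) R[i] (fun=> 1)) (vars t i).

Section Reachable.
Variable t0 : seed R n m.
Hypothesis t0_seed : is_seed t0.

Let ev_inj p : mmap (@ratfunC R (n + m)) (vars t0) p = 0 -> p = 0 :=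
  t0_seed.1.1 p.

Lemma pos_seed_binomial t k : pos_seed t0 t ->
  pos_frac (mmap (@ratfunC R (n + m)) (vars t0))
           (@meval (n + m) R[i] (fun=> 1)) (exchange_binomial t k).
Proof.
move=> [_ x_pos]; apply: pos_fracD => //; apply: big_ind => *;
  by [exact: pos_frac1 | exact: pos_fracM | exact: pos_fracXz].
Qed.

Lemma pos_seed_mutate t k : pos_seed t0 t -> pos_seed t0 (mutate k t).
Proof.
move=> t_pos; split=> [|i]; first exact/mutate_mx_skew/t_pos.1.
rewrite ffunE; case: ifP => _; last exact: t_pos.2.
by apply: pos_fracM; [exact/pos_fracV/t_pos.2 | exact: pos_seed_binomial].
Qed.

Lemma pos_seed_reachable t : mutation_equiv t0 t -> pos_seed t0 t.
Proof.
elim=> [|k u _]; last exact: pos_seed_mutate.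
split=> [|i]; first exact: t0_seed.2.
have -> : vars t0 i = mmap (@ratfunC R (n + m)) (vars t0) 'X_i.
  by rewrite mmapX mmap1U.
by apply: pos_frac_ev; rewrite /= mevalXU ltr01.
Qed.

Lemma reachable_var_neq0 t i : mutation_equiv t0 t -> vars t i != 0.
Proof. by move=> /pos_seed_reachable[_ x_pos]; apply: (pos_frac_neq0 ev_inj). Qed.

Lemma mutation_equiv_trans u v t :
  mutation_equiv u v -> mutation_equiv v t -> mutation_equiv u t.
Proof. by move=> uv; elim=> // k w _; apply: mutation_equiv_step. Qed.

(** The path from [t0] is retraced: [mutateK] undoes each step, and positivity supplies its
    nonvanishing conditions. *)
Lemma reachable_sym t : mutation_equiv t0 t -> mutation_equiv t t0.
Proof.
elim=> [|k u t0u]; first exact: mutation_equiv_refl.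
apply: mutation_equiv_trans.
have u_pos := pos_seed_reachable t0u.
rewrite -{2}[u](@mutateK k).
- exact/mutation_equiv_step/mutation_equiv_refl.
- exact: u_pos.1.
- exact: reachable_var_neq0.
- exact/(pos_frac_neq0 ev_inj)/pos_seed_binomial.
Qed.

End Reachable.

Lemma reachable_frozen t u (j : 'I_m) : mutation_equiv u t ->
  vars t (rshift n j) = vars u (rshift n j).
Proof. by elim=> // k v _ <-; rewrite vars_mutate ?eq_rlshift. Qed.

End Mutation.

Section FrozenMonomials.
Variables (R : realType) (n m : nat) (t0 : seed R n m).
Hypothesis t0_seed : is_seed t0.

Definition frozen (j : 'I_m) := vars t0 (rshift n j).

Lemma frozen_neq0 j : frozen j != 0.
Proof. exact/reachable_var_neq0/mutation_equiv_refl. Qed.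

Lemma laurent_frozen_calg v : laurent frozen v \in calg_pred t0.
Proof.
apply: rpred_prod => j _; move: (v j 0).
suff frozenX (x : ratfun R (n + m)) d : x \in calg_pred t0 -> x ^+ d \in calg_pred t0.
  case=> d; [|rewrite /exprz -exprVn]; apply: frozenX; apply/asboolP.
    exact/in_calg_var/mutation_equiv_refl.
  exact: in_calg_frozenV.
exact: rpredX.
Qed.

Definition frozen_mon v : calg t0 := Calg (laurent_frozen_calg v).

Lemma frozen_mon0 : frozen_mon 0 = 1.
Proof. by apply: val_inj; rewrite /= laurent0. Qed.

Lemma frozen_monD v w : frozen_mon (v + w) = frozen_mon v * frozen_mon w.
Proof. by apply: val_inj; rewrite /= laurentD //; apply: frozen_neq0. Qed.

Lemma frozen_monN v : frozen_mon v * frozen_mon (- v) = 1.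
Proof. by rewrite -frozen_monD subrr frozen_mon0. Qed.

Lemma frozen_mon_delta (t : seeds t0) j :
  frozen_mon (delta_mx j 0) = cvar t (rshift n j).
Proof.
apply: val_inj; rewrite /= -[delta_mx j 0]scale1r laurentZdelta expr1z.
by rewrite (reachable_frozen _ (svalP t)).
Qed.

(** Clearing denominators gives, by algebraic independence of the initial variables, an equality of
    two polynomial monomials. *)
Lemma laurent_frozen_inj v : laurent frozen v = 1 -> v = 0.
Proof.
move=> mon1; apply/colP => j; rewrite mxE.
pose X (a : 'I_m -> nat) : {mpoly R[i][n + m]} := \prod_i 'X_(rshift n i) ^+ a i.
have evX a : mmap (@ratfunC R (n + m)) (vars t0) (X a) = \prod_i frozen i ^+ a i.
  rewrite rmorph_prod; apply: eq_bigr => i _.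
  by rewrite rmorphXn /= mmapX mmap1U.
(* Positive and negative parts of [v]; [Negz d] stands for [-(d + 1)], whence [d.+1] below. *)
pose vp i := if v i 0 is Posz d then d else 0%N.
pose vn i := if v i 0 is Negz d then d.+1 else 0%N.
have vE i : v i 0 = (vp i)%:Z - (vn i)%:Z.
  by rewrite /vp /vn; case: (v i 0) => d; rewrite ?subr0 ?NegzE ?sub0r.
have XE : X vp = X vn.
  apply/eqP; rewrite -subr_eq0; apply/eqP/t0_seed.1.1.
  rewrite rmorphB /= !evX; apply/eqP; rewrite subr_eq0; apply/eqP.
  transitivity (laurent frozen v * \prod_i frozen i ^+ vn i).
    rewrite /laurent -big_split; apply: eq_bigr => i _.
    by rewrite /= ![_ ^+ _]exprnP -expfzDr ?frozen_neq0 // vE subrK.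
  by rewrite mon1 mul1r.
(* Evaluating the [j]-th frozen indeterminate at 2 and the others at 1 isolates the exponent at
   [j]. *)
have {XE} := congr1 (meval (fun i => if i == rshift n j then 2%:R else 1)) XE.
have X2 a : (X a).@[fun i => if i == rshift n j then 2%:R else 1] = 2%:R ^+ a j.
  rewrite rmorph_prod (bigD1 j) //= big1 => [|i /negPf ij].
    by rewrite mulr1 rmorphXn /= mevalXU eqxx.
  by rewrite rmorphXn /= mevalXU (inj_eq (@rshift_inj _ _)) ij expr1n.
rewrite !X2 => /eqP; rewrite -!natrX eqr_nat eqn_exp2l // => /eqP vpn.
by rewrite vE vpn subrr.
Qed.

End FrozenMonomials.

(** * Elements scaled by an endomorphism *)

Section Scaling.
Variables (R : realType) (n m : nat) (t0 : seed R n m).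
Variable s : {lrmorphism calg t0 -> calg t0}.

Definition scaled (a : calg t0) := exists2 c : R[i], c != 0 & s a = c *: a.

Lemma scaled1 : scaled 1.
Proof. by exists 1; rewrite ?oner_neq0 // rmorph1 scale1r. Qed.

Lemma scaledM a b : scaled a -> scaled b -> scaled (a * b).
Proof.
case=> c c0 sa [d d0 sb]; exists (c * d); first exact: mulf_neq0.
by rewrite rmorphM /= sa sb -scalerAl -scalerAr scalerA.
Qed.

Lemma scaledV a b : a * b = 1 -> scaled a -> scaled b.
Proof.
move=> ab [c c0 sa]; exists c^-1; first exact: invr_neq0.
have sab : s a * s b = 1 by rewrite -rmorphM ab rmorph1.
have asb : a * s b = c^-1 *: 1.
  by rewrite -sab sa -scalerAl scalerA mulVf ?scale1r.
by rewrite -[LHS]mul1r -ab [a * b]mulrC -mulrA asb -scalerAr mulr1.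
Qed.

(** The quotient [s a / a] has a constant [d]-th power, so it is constant by [constant_root]. *)
Lemma scaled_root a d : (0 < d)%N -> val a != 0 -> scaled (a ^+ d) -> scaled a.
Proof.
move=> d0 a0 [c c0 sad].
have ud : (val (s a) / val a) ^+ d = ratfunC R (n + m) c.
  rewrite expr_div_n; apply: (canLR (mulfK _)); first by rewrite expf_neq0.
  by rewrite -!rmorphXn /= sad.
have [b bE] := constant_root d0 ud.
have sa : s a = b *: a.
  by apply: val_inj; rewrite /= -[LHS](divfK a0) bE.
(* If [b = 0], then [c *: a ^+ d = s (a ^+ d) = 0] with [c != 0], which forces [a = 0]. *)
exists b => //; apply: contraNneq a0 => b0; apply/eqP.
have : c *: a ^+ d = 0 by rewrite -sad rmorphXn /= sa b0 scale0r expr0n eqn0Ngt d0.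
move=> /eqP; rewrite scaler_eq0 (negPf c0) /= => /eqP ad0.
by move/(congr1 val): ad0; rewrite rmorphXn => /eqP; rewrite expf_eq0 d0 => /eqP.
Qed.

End Scaling.

(** * Effect of a quasi-morphism on seeds, tori and scalings *)

Section QuasiMorphism.
Variables (R : realType) (n m : nat) (t1 t2 : seed R n m).
Hypotheses (t1_seed : is_seed t1) (t2_seed : is_seed t2).
Variable q : quasi_morphism t1 t2.

(** The image is closed under mutation and contains a seed reachable from [t2]; by symmetry of
    reachability every seed is reached from that one. *)
Lemma qm_seed_surj (u : seeds t2) : exists t, qm_seed q t = u.
Proof.
pose r0 : seeds t1 := exist _ t1 (mutation_equiv_refl t1).
have onto w : mutation_equiv (sval (qm_seed q r0)) w ->
    exists t, sval (qm_seed q t) = w.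
  elim=> [|k v _ [t <-]]; first by exists r0.
  by exists (mutate_seeds k t); rewrite qm_seed_mutate.
have [] := onto (sval u).
  exact: mutation_equiv_trans (reachable_sym t2_seed (svalP _)) (svalP u).
move=> t tu; exists t; case: (qm_seed q t) u tu => [v v_reach] [w w_reach] /= vw.
by subst w; congr exist; apply: Prop_irrelevance.
Qed.

(** The upper blocks [1] and [0] select the mutable variable; the lower left block contributes only
    a frozen monomial, a unit. *)
Lemma qm_dual_mutable t j : qm_dual q (cvar t (lshift m j)) =
  cvar (qm_seed q t) (lshift m j) * frozen_mon t2 (col j (dlsubmx (qm_mx q t))).
Proof.
apply: val_inj; rewrite qm_var big_split_ord /=.
have [P [Q ->]] := qm_mx_block q t; congr (_ * _).
  rewrite (bigD1 j) //= big1 => [|i /negPf ij].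
    by rewrite block_mxEul mxE eqxx mulr1 expr1z.
  by rewrite block_mxEul mxE ij.
apply: eq_bigr => i _; rewrite block_mxKdl block_mxEdl mxE.
by rewrite (reachable_frozen _ (svalP (qm_seed q t))).
Qed.

Lemma qm_dual_frozen t j : qm_dual q (cvar t (rshift n j)) =
  frozen_mon t2 (col j (drsubmx (qm_mx q t))).
Proof.
apply: val_inj; rewrite qm_var big_split_ord /=.
have [P [Q ->]] := qm_mx_block q t; rewrite big1 ?mul1r => [|i _].
  apply: eq_bigr => i _; rewrite block_mxKdr block_mxEdr mxE.
  by rewrite (reachable_frozen _ (svalP (qm_seed q t))).
by rewrite block_mxEur mxE.
Qed.

Lemma qm_dual_frozen_mon t v :
  qm_dual q (frozen_mon t1 v) = frozen_mon t2 (drsubmx (qm_mx q t) *m v).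
Proof.
elim/int_cV_ind: v => [|v w Dv Dw|v Dv|i].
- by rewrite mulmx0 !frozen_mon0 rmorph1.
- by rewrite frozen_monD // rmorphM /= Dv Dw mulmxDr frozen_monD.
- set Q := drsubmx _ in Dv *.
  rewrite -[LHS]mul1r -(frozen_monN t2_seed (Q *m - v)) [_ * frozen_mon _ (- _)]mulrC.
  rewrite -mulmxN opprK -Dv.
  by rewrite mulrAC -rmorphM /= frozen_monN // rmorph1 mul1r.
- by rewrite (frozen_mon_delta t) qm_dual_frozen -colE.
Qed.

(** Frozen monomials are units and vanish at no point, so the mutable variables alone decide. *)
Lemma qm_dual_torus (p2 : cpoint t2) t :
  (forall i, p2 (qm_dual q (cvar t i)) != 0) <-> cluster_torus (qm_seed q t) p2.
Proof.
have mon_neq0 v : p2 (frozen_mon t2 v) != 0.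
  have /(congr1 p2)/eqP := frozen_monN t2_seed v.
  rewrite rmorphM rmorph1 /=; apply: contraTneq => ->.
  by rewrite mul0r eq_sym oner_eq0.
split=> pz i; case: (split_ordP i) => j ->.
- by have := pz (lshift m j); rewrite qm_dual_mutable rmorphM /= mulf_eq0 => /norP[].
- by rewrite -frozen_mon_delta.
- rewrite qm_dual_mutable rmorphM /= mulf_eq0 negb_or mon_neq0 andbT; exact: pz.
- by rewrite qm_dual_frozen.
Qed.

Hypothesis q_inj : injective (qm_dual q).

(** A nonzero integer kernel vector would give a nontrivial frozen monomial of [t1] sent to 1,
    against injectivity. *)
Lemma qm_frozen_det t : \det (drsubmx (qm_mx q t)) != 0.
Proof.
rewrite -det_tr; apply/negP => /det0P[v v_neq0 vQ].
have : qm_dual q (frozen_mon t1 v^T) = qm_dual q 1.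
  rewrite (qm_dual_frozen_mon t) -[drsubmx _]trmxK -trmx_mul vQ trmx0.
  by rewrite frozen_mon0 rmorph1.
move=> /q_inj /(congr1 val) /(laurent_frozen_inj t1_seed) vT0.
by move: v_neq0; rewrite -[v]trmxK vT0 trmx0 eqxx.
Qed.

(* The adjugate of [Q_t] writes the [det Q_t]-th power of a frozen variable of
   A_2 as a monomial in the images of the frozen variables of A_1. *)
Lemma qm_scaled_frozen (s : {lrmorphism calg t2 -> calg t2}) t :
  (forall j, scaled s (qm_dual q (cvar t (rshift n j)))) ->
  forall v, scaled s (frozen_mon t2 v).
Proof.
move=> sc.
set Q := drsubmx (qm_mx q t).
have scQ v : scaled s (frozen_mon t2 (Q *m v)).
  elim/int_cV_ind: v => [|v w sv sw|v sv|i].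
  - by rewrite mulmx0 frozen_mon0; apply: scaled1.
  - by rewrite mulmxDr frozen_monD //; apply: scaledM.
  - by rewrite mulmxN; apply: scaledV sv; apply: frozen_monN.
  - by rewrite -colE -qm_dual_frozen.
elim/int_cV_ind => [|v w sv sw|v sv|i].
- by rewrite frozen_mon0; apply: scaled1.
- by rewrite frozen_monD //; apply: scaledM.
- by apply: scaledV sv; apply: frozen_monN.
have sdet : scaled s (frozen_mon t2 (\det Q *: delta_mx i 0)).
  by rewrite -mul_scalar_mx -mul_mx_adj -mulmxA; apply: scQ.
(* Root extraction takes a natural exponent, so a negative determinant is replaced by its opposite
   through the inverse monomial. *)
have sabs : scaled s (frozen_mon t2 (`|\det Q|%:Z *: delta_mx i 0)).
  case: (\det Q) sdet => // d; rewrite NegzE scaleNr abszN => sd.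
  by rewrite -[_ *: _]opprK; apply: scaledV sd; apply: frozen_monN.
apply: (@scaled_root _ _ _ _ _ _ `|\det Q|%N).
- by rewrite absz_gt0 qm_frozen_det.
- rewrite /= -[delta_mx _ _]scale1r laurentZdelta expr1z.
  exact: frozen_neq0.
suff -> : frozen_mon t2 (delta_mx i 0) ^+ `|\det Q| =
    frozen_mon t2 (`|\det Q|%:Z *: delta_mx i 0) by [].
by apply: val_inj; rewrite rmorphXn /= -{1}[delta_mx _ _]scale1r !laurentZdelta.
Qed.

(** Scaling passes through the injective [qm_dual]. Mutable variables correspond up to frozen
    monomials, so each direction first shows that all frozen monomials of [t2] are scaled. *)
Lemma qm_cluster_aut (s1 : {lrmorphism calg t1 -> calg t1})
    (s2 : {lrmorphism calg t2 -> calg t2}) :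
  (forall a, qm_dual q (s1 a) = s2 (qm_dual q a)) ->
  (forall t i, scaled s1 (cvar t i)) <-> (forall t i, scaled s2 (cvar t i)).
Proof.
move=> conj.
have transfer a : scaled s1 a <-> scaled s2 (qm_dual q a).
  split=> -[c c0 sa]; exists c => //; first by rewrite -conj sa linearZ.
  by apply: q_inj; rewrite conj sa linearZ.
have scD (sc : forall v, scaled s2 (frozen_mon t2 v)) t j :
    scaled s1 (cvar t (lshift m j)) <-> scaled s2 (cvar (qm_seed q t) (lshift m j)).
  rewrite transfer qm_dual_mutable; split=> sx; last exact: scaledM.
  set v := col _ _ in sx.
  rewrite -[cvar _ _]mulr1 -(frozen_monN t2_seed v) mulrA.
  exact: scaledM.
split=> sc.
- have scf : forall v, scaled s2 (frozen_mon t2 v).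
    apply: (@qm_scaled_frozen _ (exist _ t1 (mutation_equiv_refl t1))) => j.
    exact/transfer.
  move=> u i; have [t <-] := qm_seed_surj u.
  case: (split_ordP i) => j ->; first exact/scD.
  by rewrite -frozen_mon_delta.
- have scf v : scaled s2 (frozen_mon t2 v).
    elim/int_cV_ind: v => [|v w sv sw|v sv|i].
    + by rewrite frozen_mon0; apply: scaled1.
    + by rewrite frozen_monD //; apply: scaledM.
    + by apply: scaledV sv; apply: frozen_monN.
    + by rewrite (frozen_mon_delta (exist _ t2 (mutation_equiv_refl t2))).
  move=> t i; case: (split_ordP i) => j ->; first exact/scD.
  by apply/transfer; rewrite qm_dual_frozen.
Qed.

End QuasiMorphism.

(** * Inverse morphisms and transfer of points *)

Lemma lrmorphism_inverse (K : nzRingType) (A B : lalgType K)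
    (f : {lrmorphism A -> B}) : bijective f ->
  exists g : {lrmorphism B -> A}, cancel f g /\ cancel g f.
Proof.
case=> g fK gK.
pose gZ := GRing.isLinear.Build K B A _ g (can2_linear fK gK).
pose gM := GRing.isMonoidMorphism.Build B A g (can2_monoid_morphism fK gK).
pose G : {lrmorphism B -> A} := HB.pack g gZ gM.
by exists G.
Qed.

Section QuasiIsomorphism.
Variables (R : realType) (n m : nat) (t1 t2 : seed R n m).
Hypotheses (t1_seed : is_seed t1) (t2_seed : is_seed t2).
Variables (q : quasi_morphism t1 t2) (g : {lrmorphism calg t2 -> calg t1}).
Hypotheses (qK : cancel (qm_dual q) g) (gK : cancel g (qm_dual q)).
Variables (p1 : cpoint t1) (p2 : cpoint t2).
Hypothesis p12 : forall a, p1 a = p2 (qm_dual q a).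

(** Tori correspond along [qm_seed], whose surjectivity ensures that no torus of [t2] is missed. *)
Lemma deep_points_dual : deep_points p1 <-> deep_points p2.
Proof.
have torus t : cluster_torus t p1 <-> cluster_torus (qm_seed q t) p2.
  rewrite -(qm_dual_torus t2_seed).
  by split=> pt i; have := pt i; rewrite p12.
split=> deep [t _ pt]; apply: deep.
  have [u ut] := qm_seed_surj t2_seed q t.
  by exists u => //; apply/torus; rewrite ut.
by exists (qm_seed q t) => //; apply/torus.
Qed.

Lemma stabilized_points_dual : stabilized_points p1 <-> stabilized_points p2.
Proof.
have aut := qm_cluster_aut t1_seed t2_seed (can_inj qK).
split=> -[s [[s_bij sc] s_id sp]].
- pose s2 : {lrmorphism calg t2 -> calg t2} := qm_dual q \o s \o g.
  have s2E a : qm_dual q (s a) = s2 (qm_dual q a) by rewrite /s2 /= qK.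
  exists s2; split.
  + split; last exact/(aut _ _ s2E).
    by apply: bij_comp; [apply: bij_comp => //; exists g | exists (qm_dual q)].
  + by move=> s2_id; apply: s_id => a; rewrite -[LHS]qK s2E s2_id qK.
  + by move=> a; rewrite /s2 /= -p12 sp p12 gK.
- pose s1 : {lrmorphism calg t1 -> calg t1} := g \o s \o qm_dual q.
  have s1E a : qm_dual q (s1 a) = s (qm_dual q a) by rewrite /s1 /= gK.
  exists s1; split.
  + split; last exact/(aut _ _ s1E).
    by apply: bij_comp; [apply: bij_comp => //; exists (qm_dual q) | exists g].
  + by move=> s1_id; apply: s_id => a; rewrite -[a]gK -s1E s1_id.
  + by move=> a; rewrite !p12 s1E sp.
Qed.

End QuasiIsomorphism.

Theorem proposition3p15 (R : realType) (n m : nat) (t1 t2 : seed R n m)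
    (t1_seed : is_seed t1) (t2_seed : is_seed t2) :
  quasi_isomorphic t1 t2 ->
  (no_mysterious_points t1 <-> no_mysterious_points t2).
Proof.
case=> q /lrmorphism_inverse[g [qK gK]].
have stab := stabilized_points_dual t1_seed t2_seed qK gK.
have deep := deep_points_dual t2_seed (q := q).
split=> no_myst; apply/predeqP => p.
(* Points are matched by precomposition, with [qm_dual q] here and with its inverse [g] in the other
   direction. *)
- pose p1 : cpoint t1 := p \o qm_dual q.
  have p1E a : p1 a = p (qm_dual q a) by [].
  by rewrite -(stab _ _ p1E) -(deep _ _ p1E) no_myst.
- pose p2 : cpoint t2 := p \o g.
  have p2E a : p a = p2 (qm_dual q a) by rewrite /p2 /= qK.
  by rewrite (stab _ _ p2E) (deep _ _ p2E) no_myst.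
Qed.
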